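(* Let $m\ge2$. Then $G_m$ is the largest divisor of $m$ all of whose prime factors divide $2^m-1$, it divides the odd part of $m$, and $$\Delta_m=\Omega_m+\log G_m .$$
   Context: $\mathrm{rad}(n)$ is the product of the distinct primes dividing $n$, and $v_p$ is the $p$-adic valuation. Put $\Delta_m=\log\bigl((2^m-1)/\mathrm{rad}(2^m-1)\bigr)$. For an odd prime $p$, let $d_p$ be the multiplicative order of $2$ modulo $p$ and $A_p=v_p(2^{d_p}-1)$. $\mathcal{W}$ is the set of Wieferich primes, i.e. odd primes $p$ with $2^{p-1}\equiv1\pmod{p^2}$, and $\mathcal{W}(m)=\{p\in\mathcal{W}:p\mid2^m-1\}$. Put $\Omega_m=\sum_{p\in\mathcal{W}(m)}(A_p-1)\log p$ (an empty sum being $0$) and $G_m=\prod_{p\mid2^m-1}p^{v_p(m)}$ (product over primes $p$ dividing $2^m-1$). The odd part of $m$ is $m/2^{v_2(m)}$. *)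

(* Defs.v *)
From mathcomp Require Import all_boot all_order all_algebra all_fingroup.
From mathcomp Require Import reals exp.

Set Implicit Arguments.
Unset Strict Implicit.
Unset Printing Implicit Defensive.

Import GRing.Theory.

Local Open Scope nat_scope.

Definition rad (n : nat) : nat := \prod_(p <- primes n) p.

(* The multiplicative order of 2 modulo an odd prime p, as the order of an
   element of the unit group of 'F_p. For an odd prime p the class of 2 is a
   unit, so the default value 1 of insubd is not used; for other p the value
   is meaningless. *)
Definition ord2 (p : nat) : nat :=
  #[insubd (1%g : {unit 'F_p}) (2%:R : 'F_p)%R]%g.

Definition A (p : nat) : nat := logn p (2 ^ ord2 p - 1).

Definition wieferich (p : nat) : bool :=
  [&& prime p, odd p & 2 ^ (p - 1) == 1 %[mod p ^ 2]].

Definition G (m : nat) : nat := \prod_(p <- primes (2 ^ m - 1)) p ^ logn p m.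

Definition odd_part (m : nat) : nat := m %/ 2 ^ logn 2 m.

Local Open Scope ring_scope.

Definition Delta (R : realType) (m : nat) : R :=
  ln ((2 ^ m - 1)%N%:R / (rad (2 ^ m - 1))%:R).

Definition Omega (R : realType) (m : nat) : R :=
  \sum_(p <- primes (2 ^ m - 1) | wieferich p) ((A p)%:R - 1) * ln p%:R.

(* Main.v *)
Require Import Defs.
From mathcomp Require Import all_boot all_order all_algebra all_fingroup.
From mathcomp Require Import cyclic ring.
From mathcomp Require Import reals exp.

(** Put N = 2 ^ m - 1. Taking logarithms in the factorization of N gives
    Delta_m = sum over p | N of (v_p(N) - 1) log p, so the formula reduces to
    one identity for each prime p dividing N (such a p is odd).

    That identity is lifting the exponent: if p is odd and p | a - 1, then
    v_p(a ^ n - 1) = v_p(a - 1) + v_p(n) ([logn_expn_sub1]). Apply it to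
    a = 2 ^ d, with d the order of 2 modulo p. Since d divides m, and since d
    divides p - 1 and hence is prime to p, it yields v_p(N) = A_p + v_p(m)
    ([logn_mersenne]). The summand (v_p(N) - 1) log p therefore splits as
    (A_p - 1) log p + v_p(m) log p. The second terms add up to log G_m. The
    same identity with m replaced by p - 1 shows that p is a Wieferich prime
    exactly when A_p >= 2 ([wieferichE]), so the first terms vanish at the
    other primes and add up to Omega_m.

    The divisibility claims hold because G_m is the pi-part of m, where pi is
    the set of prime divisors of N ([G_partn]); it is odd because N is. *)

Local Open Scope ring_scope.

Import GRing.Theory Num.Theory.

(** * Lifting the exponent *)

Section LiftingTheExponent.
Local Open Scope nat_scope.

(** The hypotheses exclude a ^ n - 1 = 0, to which [logn] gives the value 0. *)
Lemma logn_expn_sub1_sum p a n : 1 < a -> 0 < n ->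
  logn p (a ^ n - 1) = logn p (a - 1) + logn p (\sum_(i < n) a ^ i).
Proof.
case: a => [//|[//|a]] _; case: n => // n _.
by rewrite !subn1 predn_exp lognM // big_ord_recl addn_gt0 expn0.
Qed.

Lemma sum_exp_modn p a n : a = 1 %[mod p] -> \sum_(i < n) a ^ i = n %[mod p].
Proof.
move=> a1; elim: n => [|n IHn]; first by rewrite big_ord0.
by rewrite big_ord_recr /= -modnDm IHn -modnXm a1 modnXm exp1n modnDm addn1.
Qed.

Lemma exp_modn_sqr p b n : (1 + b * p) ^ n = 1 + n * (b * p) %[mod p ^ 2].
Proof.
elim: n => [|n IHn]; first by rewrite expn0.
rewrite expnS -modnMmr IHn modnMmr.
have -> : (1 + b * p) * (1 + n * (b * p)) =
    n * b * b * p ^ 2 + (1 + n.+1 * (b * p)) by ring.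
by rewrite modnMDl.
Qed.

(** Modulo p ^ 2 the binomial expansion of each power stops after its linear
    term, so the sum of the exponents contributes the coefficient 'C(n, 2). *)
Lemma sum_exp_modn_sqr p b n :
  \sum_(i < n) (1 + b * p) ^ i = n + 'C(n, 2) * (b * p) %[mod p ^ 2].
Proof.
elim: n => [|n IHn]; first by rewrite big_ord0.
rewrite big_ord_recr /= -modnDm IHn exp_modn_sqr modnDm binS bin1 mulnDl.
by rewrite addnACA addn1.
Qed.

(** Writing a = 1 + b p, the sum is p + 'C(p, 2) b p modulo p ^ 2, and p
    divides 'C(p, 2) because p is odd; so the sum is p modulo p ^ 2. This fails
    for p = 2: with a = 3 the sum is 4. *)
Lemma logn_sum_exp_prime p a : prime p -> odd p -> 1 < a -> p %| a - 1 ->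
  logn p (\sum_(i < p) a ^ i) = 1.
Proof.
move=> pP pO a_gt1 /dvdnP [b ab].
have ea : a = 1 + b * p by rewrite -ab subnKC // ltnW.
have p_gt2 : 2 < p by case: p pP pO {ab ea} => [|[|[|]]].
have S_gt0 : 0 < \sum_(i < p) a ^ i.
  by case: p pP {pO ab ea p_gt2} => // p _; rewrite big_ord_recl addn_gt0 expn0.
have Sp : \sum_(i < p) a ^ i = p %[mod p ^ 2].
  rewrite ea sum_exp_modn_sqr.
  have /dvdnP [c ->] := prime_dvd_bin (k := 2) pP p_gt2.
  by rewrite -mulnA (mulnCA p) mulnA -[p * p]/(p ^ 2) addnC modnMDl.
have dvdS d : d %| p ^ 2 -> (d %| \sum_(i < p) a ^ i) = (d %| p).
  by move=> dp2; rewrite /dvdn -(modn_dvdm _ dp2) Sp modn_dvdm.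
apply/eqP; rewrite eqn_leq leqNgt -(pfactor_dvdn 2) // -(pfactor_dvdn 1) //.
rewrite !dvdS ?dvdn_exp2l // expn1 dvdnn andbT.
by rewrite gtnNdvd ?prime_gt0 // -{1}(expn1 p) ltn_exp2l // prime_gt1.
Qed.

(** Lifting the exponent, by removing from n one factor p at a time. When p
    does not divide n, the cofactor of a - 1 in a ^ n - 1 is n modulo p, hence
    prime to p. When n = k p, the cofactor of a ^ k - 1 is a sum of p powers of
    a ^ k, of valuation exactly 1. *)
Lemma logn_expn_sub1 p a n : prime p -> odd p -> 1 < a -> p %| a - 1 ->
  0 < n -> logn p (a ^ n - 1) = logn p (a - 1) + logn p n.
Proof.
move=> pP pO a_gt1 pa; elim/ltn_ind: n => n IHn n_gt0.
case: (boolP (p %| n)) => [/dvdnP [k en]|pNn]; last first.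
  rewrite logn_expn_sub1_sum //; congr (_ + _).
  rewrite !logn_coprime ?prime_coprime //.
  rewrite /dvdn sum_exp_modn //.
  by apply/eqP; rewrite eqn_mod_dvd // ltnW.
have k_gt0 : 0 < k by move: n_gt0; rewrite en muln_gt0 => /andP[].
have k_lt : k < n by rewrite en ltn_Pmulr // prime_gt1.
have ak_gt1 : 1 < a ^ k by rewrite -{1}(expn0 a) ltn_exp2l.
rewrite en (lognM _ k_gt0 (prime_gt0 pP)) (logn_prime _ pP) eqxx expnM.
rewrite logn_expn_sub1_sum ?prime_gt0 // IHn // logn_sum_exp_prime ?addnA //.
by rewrite subn1 predn_exp -subn1 dvdn_mulr.
Qed.

End LiftingTheExponent.

(** * The order of 2 modulo an odd prime *)

Section OrderOfTwo.
Local Open Scope nat_scope.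
Variable p : nat.
Hypotheses (pP : prime p) (pO : odd p).

Lemma ord2_dvdn n : (ord2 p %| n) = (p %| 2 ^ n - 1).
Proof.
have u2 : ((2%:R : 'F_p) \is a GRing.unit)%R.
  rewrite unitfE -(dvdn_pcharf (pchar_Fp pP)) dvdn_prime2 //.
  by case: eqP pO => [->|].
rewrite /ord2 order_dvdn -val_eqE /= FinRing.val_unitX insubdK //= -natrX.
rewrite -subr_eq0 -(natrB _ (expn_gt0 2 n)).
by rewrite (dvdn_pcharf (pchar_Fp pP)).
Qed.

Lemma ord2_dvdn_pred : ord2 p %| p - 1.
Proof.
rewrite ord2_dvdn -eqn_mod_dvd ?expn_gt0 //; apply/eqP.
by rewrite subn1 -totient_prime // Euler_exp_totient // coprime2n.
Qed.

(** For the order of 2, which divides p - 1, this says that passing from m to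
    m / d_p does not change the p-adic valuation. *)
Lemma logn_dvd_pred n : n %| p - 1 -> logn p n = 0.
Proof.
move=> n_dvd; apply: logn_coprime; rewrite prime_coprime //.
apply/negP => /dvdn_trans/(_ n_dvd).
by rewrite gtnNdvd ?subn_gt0 ?prime_gt1 ?ltn_subrL /= ?prime_gt0.
Qed.

(** Since p divides 2 ^ n - 1, the order d of 2 divides n, and
    2 ^ n = (2 ^ d) ^ (n / d) lets the exponent be lifted from 2 ^ d - 1, whose
    valuation is A p. *)
Lemma logn_mersenne n : 0 < n -> p %| 2 ^ n - 1 ->
  logn p (2 ^ n - 1) = A p + logn p n.
Proof.
move=> n_gt0; rewrite -ord2_dvdn => /dvdnP [k en].
move: n_gt0; rewrite en muln_gt0 => /andP [k_gt0 d_gt0].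
rewrite lognM // (logn_dvd_pred _ ord2_dvdn_pred) addn0 mulnC expnM.
rewrite logn_expn_sub1 //.
  by rewrite -{1}(expn0 2) ltn_exp2l.
by rewrite -ord2_dvdn.
Qed.

(** By [logn_mersenne] at n = p - 1, which is prime to p, the valuation of
    2 ^ (p - 1) - 1 is A p itself. *)
Lemma wieferichE : wieferich p = (1 < A p).
Proof.
have pm1 : 0 < p - 1 by rewrite subn_gt0 prime_gt1.
have M_gt0 : 0 < 2 ^ (p - 1) - 1 by rewrite subn_gt0 -{1}(expn0 2) ltn_exp2l.
rewrite /wieferich pP pO eqn_mod_dvd ?expn_gt0 // pfactor_dvdn //.
rewrite logn_mersenne -?ord2_dvdn ?ord2_dvdn_pred //.
by rewrite logn_dvd_pred // addn0.
Qed.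

Lemma A_gt0 : 0 < A p.
Proof.
rewrite /A logn_gt0 mem_primes pP -ord2_dvdn dvdnn andbT /=.
by rewrite subn_gt0 -{1}(expn0 2) ltn_exp2l // order_gt0.
Qed.

End OrderOfTwo.

(** * The greatest divisor supported on the primes of 2 ^ m - 1 *)

Section PartOfExponent.
Local Open Scope nat_scope.

Lemma G_partn m : 0 < m -> G m = m`_\pi(2 ^ m - 1).
Proof.
move=> m_gt0; set N := 2 ^ m - 1.
(* The default range of a pi-part stops at m, below some primes of N. *)
rewrite (widen_partn (m := maxn m N)) ?leq_maxl // /G -/N.
rewrite -[RHS]big_filter; apply: perm_big; apply: uniq_perm.
- exact: primes_uniq.
- by rewrite filter_uniq // iota_uniq.
move=> q; rewrite mem_filter mem_index_iota /= ltnS.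
case: (boolP (q \in primes N)) => qN; rewrite ?(negPf qN) ?qN //=.
  symmetry; apply: leq_trans (leq_maxr m N).
  by move: qN; rewrite mem_primes => /and3P [_ ? /dvdn_leq ->].
Qed.

End PartOfExponent.

(** * Logarithms of factored integers *)

Section Logarithms.
Variable R : realType.

Lemma ln_prod_natX (s : seq nat) (e : nat -> nat) :
  {in s, forall p, prime p} ->
  ln (\prod_(p <- s) p ^ e p)%N%:R = \sum_(p <- s) (e p)%:R * ln p%:R :> R.
Proof.
elim: s => [|p s IHs] sP; first by rewrite !big_nil ln1.
have p_gt0 : (0 < p)%N by rewrite prime_gt0 // sP ?mem_head.
rewrite !big_cons natrM lnM ?posrE ?ltr0n ?expn_gt0 ?p_gt0 //; last first.
  rewrite big_seq prodn_cond_gt0 // => q qs.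
  by rewrite expn_gt0 prime_gt0 // sP // in_cons qs orbT.
rewrite natrX lnXn ?ltr0n // mulr_natl IHs // => q qs.
by rewrite sP // in_cons qs orbT.
Qed.

Lemma ln_div_rad n : (0 < n)%N ->
  ln (n%:R / (Defs.rad n)%:R) =
    \sum_(p <- primes n) ((logn p n)%:R - 1) * ln p%:R :> R.
Proof.
move=> n_gt0; have pP : {in primes n, forall p, prime p}.
  by move=> p; rewrite mem_primes => /andP [].
have ln_rad : ln (Defs.rad n)%:R = \sum_(p <- primes n) ln p%:R :> R.
  rewrite /Defs.rad -(eq_bigr _ (fun p _ => expn1 p)).
  rewrite (ln_prod_natX _ (fun=> 1%N)) //.
  by apply: eq_bigr => p _; rewrite mul1r.
rewrite ln_div ?posrE ?ltr0n //; last first.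
  by rewrite /Defs.rad big_seq prodn_cond_gt0 // => p /pP /prime_gt0.
rewrite ln_rad {1}(prod_prime_decomp n_gt0) prime_decompE big_map /=.
by rewrite ln_prod_natX // -sumrB; apply: eq_bigr => p _; rewrite mulrBl mul1r.
Qed.

End Logarithms.

(** * The decomposition of Delta *)

Theorem theorem6p3 (R : realType) (m : nat) (hm : (2 <= m)%N) :
  [/\ [/\ (G m %| m)%N,
          (forall p : nat, prime p -> (p %| G m)%N -> (p %| 2 ^ m - 1)%N)
        & (forall d : nat, (d %| m)%N ->
             (forall p : nat, prime p -> (p %| d)%N -> (p %| 2 ^ m - 1)%N) ->
             (d <= G m)%N)],
      (G m %| odd_part m)%N
    & Delta R m = Omega R m + ln (G m)%:R].
Proof.
have m_gt0 : (0 < m)%N by apply: ltnW.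
have N_gt0 : (0 < 2 ^ m - 1)%N by rewrite subn_gt0 -{1}(expn0 2) ltn_exp2l.
have N_odd : odd (2 ^ m - 1)%N.
  by rewrite oddB ?expn_gt0 // oddX; case: m m_gt0 {hm N_gt0}.
have in_piN p : prime p -> (p \in \pi(2 ^ m - 1)%N) = (p %| 2 ^ m - 1)%N.
  by move=> pP; rewrite mem_primes pP N_gt0.
have G_primes p : prime p -> (p %| G m)%N -> (p %| 2 ^ m - 1)%N.
  rewrite (G_partn _ m_gt0) => pP pG.
  rewrite -in_piN //; apply: (pnatPpi (part_pnat _ m)).
  by rewrite mem_primes pP part_gt0.
have G_dvd : (G m %| m)%N by rewrite (G_partn _ m_gt0) dvdn_part.
split; [split=> // d dm dN | |].
- rewrite dvdn_leq // (G_partn _ m_gt0) ?part_gt0 //.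
  have d_gt0 := dvdn_gt0 m_gt0 dm.
  have /part_pnat_id <- : \pi(2 ^ m - 1)%N.-nat d.
    by apply/(pnatP _ d_gt0) => p pP pd; rewrite in_piN // dN.
  exact: partn_dvd.
- have G_odd : coprime (G m) (2 ^ logn 2 m).
    rewrite coprimeXr // coprimen2; apply: contraLR N_odd; rewrite -!dvdn2.
    exact: G_primes.
  by rewrite -(Gauss_dvdl _ G_odd) /odd_part divnK // pfactor_dvdnn.
rewrite /Delta ln_div_rad // /Omega /G ln_prod_natX; last first.
  by move=> p; rewrite mem_primes => /andP [].
rewrite [X in X + _]big_mkcond -big_split /=.
apply: eq_big_seq => p; rewrite mem_primes => /and3P [pP _ pN].
have pO : odd p by apply: dvdn_odd pN N_odd.
rewrite logn_mersenne // wieferichE // natrD addrAC mulrDl.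
(* Away from the Wieferich primes A p = 1, so the missing summand is 0. *)
case: ltnP => // A_le1.
have -> : A p = 1%N by apply/eqP; rewrite eqn_leq A_le1 A_gt0.
by rewrite subrr mul0r.
Qed.
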